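(* Let $\gamma_n=o(n)$ and $\lambda_n=\Omega(\sqrt{n})$. Let $K:\mathbb{N}_0\to\mathbb{N}_0$, $n\mapsto K_n$, be a scaling and let \[ r_3(\gamma_n,\lambda_n) = 1+\frac{\log(1+\gamma_n/\lambda_n)}{\log 2 + 1/2}. \] If $K_n > r_3(\gamma_n,\lambda_n)$ for all $n$, then \[ \lim_{n\to\infty} \mathbb{P}\big[\,|C_{max}(n,K_n,\gamma_n)| > n-\gamma_n-\lambda_n\,\big] = 1. \]
   Context: Random K-out graph $\mathbb{H}(n;K_n)$: on vertex set $V=\{v_1,\dots,v_n\}$ with labels $\mathcal{N}=\{1,\dots,n\}$, each node $v_i$ independently selects a set $\Gamma_{n,i}\subseteq \mathcal{N}\setminus\{i\}$ of $K_n$ distinct labels uniformly at random (the sets $\Gamma_{n,1},\dots,\Gamma_{n,n}$ are mutually independent). Distinct nodes $v_i,v_j$ are adjacent if $j\in\Gamma_{n,i}$ or $i\in\Gamma_{n,j}$ (undirected graph). The graph $\mathbb{H}(n;K_n,\gamma_n)$ is obtained by choosing a set $D\subset V$ of $\gamma_n$ nodes uniformly at random and deleting them: it has vertex set $R=V\setminus D$, and two distinct vertices of $R$ are adjacent iff they are adjacent in $\mathbb{H}(n;K_n)$. $C_{max}(n,K_n,\gamma_n)$ denotes the vertex set of a largest connected component of $\mathbb{H}(n;K_n,\gamma_n)$. $\log$ is the natural logarithm; Landau notation is as $n\to\infty$. *)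

(* Defs.v *)
From mathcomp Require Import all_boot all_order all_algebra.
From mathcomp Require Import all_classical all_reals all_analysis.
Set Implicit Arguments. Unset Strict Implicit. Unset Printing Implicit Defensive.
Import Order.TTheory GRing.Theory Num.Theory.
Local Open Scope ring_scope.

(* Sample space of H(n;K,gamma): a choice Gamma : 'I_n -> {set 'I_n} of the
   K-out selections together with the deleted set D. *)
Definition outcome (n : nat) : finType :=
  ({ffun 'I_n -> {set 'I_n}} * {set 'I_n})%type.

(* Admissible outcomes: Gamma i is a K-subset of N \ {i}, |D| = gamma.
   The uniform measure on admissible outcomes is exactly the product of the
   independent uniform choices of Gamma_1..Gamma_n and of D. *)
Definition admissible (n K gamma : nat) (w : outcome n) : bool :=
  [forall i : 'I_n, (i \notin w.1 i) && (#|w.1 i| == K)] && (#|w.2| == gamma).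

Definition adj n (G : {ffun 'I_n -> {set 'I_n}}) : rel 'I_n :=
  fun i j => (i != j) && ((j \in G i) || (i \in G j)).

Definition adjR n (w : outcome n) : rel 'I_n :=
  fun i j => [&& i \notin w.2, j \notin w.2 & adj w.1 i j].

(* size of a largest connected component of H(n;K,gamma) (0 if R is empty) *)
Definition Cmax_size n (w : outcome n) : nat :=
  \max_(i in ~: w.2) #|[set j | connect (adjR w) i j]|.

Definition prob {R : realType} (n K gamma : nat) (E : pred (outcome n)) : R :=
  (#|[set w | @admissible n K gamma w && E w]|%:R / #|[set w | @admissible n K gamma w]|%:R).

Definition r3 {R : realType} (gamma lambda : R) : R :=
  1 + ln (1 + gamma / lambda) / (ln 2 + 2^-1).

Definition little_o_n {R : realType} (g : nat -> R) : Prop :=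
  forall eps : R, 0 < eps -> exists N : nat, forall n, (N <= n)%N -> `|g n| <= eps * n%:R.

Definition big_omega_sqrt {R : realType} (l : nat -> R) : Prop :=
  exists c : R, 0 < c /\ exists N : nat, forall n, (N <= n)%N -> c * Num.sqrt (n%:R) <= l n.

(* Main.v *)
(** If the largest component misses at least [lambda] of the [m = n - gamma]
    surviving vertices, then some set of [s] survivors with
    [lambda <= s <= m / 2] is isolated from the others. A given such set is
    isolated with probability at most
    [((s + gamma) / n) ^ (K s) * (1 - s / n) ^ (K (m - s))], and there are
    ['C(m, s) <= (n / s) ^ s * (1 - s / n) ^ - (m - s)] of them. The union bound
    over sets of size [s] is therefore at most
    [(1 + gamma / s) ^ s * (((s + gamma) / n) ^ s * (1 - s / n) ^ (m - s)) ^ (K - 1)].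
    The hypothesis on [K] says [1 + gamma / lambda < (2 sqrt e) ^ (K - 1)], which
    makes this at most [exp (- s / 32)], and the sum over [s >= lambda] tends to
    [0]. When [lambda] exceeds [n / 8] it is replaced by [n / 8], for which the
    bound on [1 + gamma / lambda] is automatic. *)

Require Import Defs.
From mathcomp Require Import all_boot all_order all_algebra.
From mathcomp Require Import all_classical all_reals all_analysis.
From mathcomp Require Import zify ring lra.
Set Implicit Arguments. Unset Strict Implicit. Unset Printing Implicit Defensive.
Import Order.TTheory GRing.Theory Num.Theory.
Local Open Scope ring_scope.

(** * Isolated vertex sets in the surviving graph *)

Lemma adjR_sym n (w : outcome n) : symmetric (adjR w).
Proof.
move=> i j; rewrite /adjR /adj eq_sym andbA [(i \notin _) && _]andbC -andbA.
by rewrite [(i \in _) || _]orbC.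
Qed.

(** These sets are the unions of components of the surviving graph; unlike components, they are
    stable under difference. *)
Definition isolated_in n (w : outcome n) (S : {set 'I_n}) : bool :=
  (S \subset ~: w.2) &&
  [forall i, forall j, adjR w i j ==> ((i \in S) == (j \in S))].

Lemma isolated_closed n (w : outcome n) (S : {set 'I_n}) :
  isolated_in w S -> fingraph.closed (adjR w) S.
Proof. by case/andP=> _ /'forall_forallP h i j ij; apply/eqP/(implyP (h i j)). Qed.

Lemma closed_isolated n (w : outcome n) (S : {set 'I_n}) :
  S \subset ~: w.2 -> fingraph.closed (adjR w) S -> isolated_in w S.
Proof.
move=> sSR clS; rewrite /isolated_in sSR; apply/'forall_forallP => i j.
by apply/implyP => ij; rewrite (clS i j ij).
Qed.

Lemma isolatedD n (w : outcome n) (S T : {set 'I_n}) :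
  isolated_in w S -> isolated_in w T -> isolated_in w (S :\: T).
Proof.
move=> iS iT; apply: closed_isolated => [|i j ij].
  by apply: fintype.subset_trans (subsetDl _ _) _; case/andP: iS.
by rewrite !inE (isolated_closed iS ij) (isolated_closed iT ij).
Qed.

(* A smallest isolated set with at least [l] vertices is either a component or
   has fewer than [2 l] vertices; in the former case its complement is the
   desired set when it is too large. *)
Lemma small_Cmax_isolated n (w : outcome n) (l : nat) :
  (4 * l <= #|~: w.2|)%N -> (Cmax_size w + l <= #|~: w.2|)%N ->
  exists S : {set 'I_n},
    [/\ isolated_in w S, (l <= #|S|)%N & (2 * #|S| <= #|~: w.2|)%N].
Proof.
move=> l4 lC; set R := ~: w.2 in l4 lC *.
have iR : isolated_in w R.
  apply: closed_isolated => // i j /and3P[iD jD _].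
  by rewrite !inE (negPf iD) (negPf jD).
pose P (S : {set 'I_n}) := isolated_in w S && (l <= #|S|)%N.
have PR : P R by rewrite /P iR (leq_trans _ l4) // leq_pmull.
case: (arg_minnP (fun S : {set 'I_n} => #|S|) PR) => S /andP[iS lS] minS.
move: l4 lC; rewrite -/R => l4 lC.
have [hS|hS] := leqP (2 * #|S|) #|R|; first by exists S; split.
have /card_gt0P[x xS] : (0 < #|S|)%N by lia.
have sSR : S \subset R by case/andP: iS.
pose C := [set j | connect (adjR w) x j].
have sCS : C \subset S.
  apply/fintype.subsetP => y; rewrite inE => /(closed_connect (isolated_closed iS)).
  by rewrite xS.
have iC : isolated_in w C.
  apply: closed_isolated; first exact: fintype.subset_trans sSR.
  move=> i j ij; rewrite !inE.
  exact: (connect_closed (sym_connect_sym (@adjR_sym n w)) x).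
have xC : x \in C by rewrite inE connect0.
have C0 : (0 < #|C|)%N by apply/card_gt0P; exists x.
have cSC : (#|S :\: C| + #|C| = #|S|)%N.
  by rewrite cardsD (finset.setIidPr sCS) subnK // subset_leq_card.
have cRS : (#|R :\: S| + #|S| = #|R|)%N.
  by rewrite cardsD (finset.setIidPr sSR) subnK // subset_leq_card.
(* [S :\: C] is isolated and misses [x], so minimality of [S] keeps it below [l]. *)
have SC_l : (#|S :\: C| < l)%N.
  rewrite ltnNge; apply/negP => h; have := minS (S :\: C).
  by rewrite /P isolatedD // h => /(_ isT); lia.
(* If also [|C| < l], then [|S| < 2 l], against [4 l <= |R| < 2 |S|]. Otherwise minimality gives
   [|S| <= |C| <= Cmax_size w], so [R :\: S] keeps at least [l] vertices. *)
have [lCc|Cl] := leqP l #|C|; last by lia.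
have CM : (#|C| <= Cmax_size w)%N.
  by rewrite /Cmax_size (bigD1 x) ?(fintype.subsetP sSR) //= leq_maxl.
have SC : (#|S| <= #|C|)%N by apply: minS; rewrite /P iC.
by exists (R :\: S); split; [exact: isolatedD| lia | lia].
Qed.

(** Factor by factor, [(a - j) (b + 1) <= (b - j) (a + 1)]. The successors count the selecting
    vertex itself, so that the ratio becomes [|T| / n] for a set [T] of allowed vertices. *)
Lemma leq_bin_expn (a b k : nat) :
  (a <= b)%N -> ('C(a, k) * b.+1 ^ k <= 'C(b, k) * a.+1 ^ k)%N.
Proof.
move=> ab; rewrite -(leq_pmul2r (fact_gt0 k)).
rewrite mulnAC bin_ffact [leqRHS]mulnAC bin_ffact.
elim: k => [|k IHk]; first by rewrite !ffactn0.
rewrite !ffactnSr !expnSr mulnACA [leqRHS]mulnACA leq_mul //.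
nia.
Qed.

(** * Counting the selections compatible with a cut *)

Section Counting.
Variables (n K : nat).
Implicit Types (D S : {set 'I_n}) (G : {ffun 'I_n -> {set 'I_n}}).

Definition out_choices (T : {set 'I_n}) (i : 'I_n) : {set {set 'I_n}} :=
  [set A : {set 'I_n} | A \subset T :\ i & #|A| == K].

Lemma card_out_choices (T : {set 'I_n}) (i : 'I_n) :
  i \in T -> #|out_choices T i| = 'C(#|T|.-1, K).
Proof. by move=> iT; rewrite cards_draws (cardsD1 i T) iT. Qed.

(* The vertices that [i] may select when [S] is isolated from the rest of the
   graph once [D] is deleted. *)
Definition allowed D S (i : 'I_n) : {set 'I_n} :=
  if i \in S then S :|: D else if i \in D then [set: 'I_n] else ~: S.

Lemma mem_allowed D S i : i \in allowed D S i.
Proof. by rewrite /allowed; case: ifPn => iS; [|case: ifP => _]; rewrite !inE ?iS. Qed.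

Lemma card_Gamma (T : 'I_n -> {set 'I_n}) : (forall i, i \in T i) ->
  #|family (fun i => mem (out_choices (T i) i))| = (\prod_i 'C(#|T i|.-1, K))%N.
Proof.
move=> iT; rewrite card_family foldrE big_map big_enum /=.
by apply: eq_bigr => i _; rewrite -(card_out_choices (iT i)); apply: eq_card.
Qed.

Lemma card_admissible gamma :
  #|[set w | @admissible n K gamma w]| = ('C(n, gamma) * 'C(n.-1, K) ^ n)%N.
Proof.
pose F := family (fun i => mem (out_choices [set: 'I_n] i)).
have -> : [set w | @admissible n K gamma w] =
    finset.setX [set G in F] [set D : {set 'I_n} | #|D| == gamma].
  apply/finset.setP => -[G D]; rewrite finset.in_setX !finset.in_set /admissible /=.
  congr (_ && _).
  apply/forallP/familyP => h i; move: (h i);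
  by rewrite /out_choices !inE finset.subsetD1 finset.subsetT.
rewrite cardsX cardsE card_Gamma; last by move=> i; rewrite inE.
rewrite mulnC; congr muln.
  have := cards_draws [set: 'I_n] gamma; rewrite cardsT card_ord => <-.
  by apply: eq_card => A; rewrite !inE finset.subsetT.
by rewrite prod_nat_const cardsT card_ord.
Qed.

(** A selection between [S] and a survivor outside [S], in either direction, would be an edge
    leaving [S]. *)
Lemma isolated_allowed G D S gamma :
  admissible K gamma (G, D) -> isolated_in (G, D) S ->
  G \in family (fun i => mem (out_choices (allowed D S i) i)).
Proof.
case/andP=> /forallP/= h _ iS; have sSR : S \subset ~: D by case/andP: iS.
apply/familyP => i; case/andP: (h i) => iG cG.
rewrite !inE cG finset.subsetD1 iG !andbT; apply/fintype.subsetP => j jG.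
have ij : i != j by apply: contraNneq iG => {1}->.
rewrite /allowed; case: ifPn => iS'; last case: ifPn => iD; rewrite !inE //.
  have iD : i \notin D by move/fintype.subsetP: sSR => /(_ _ iS'); rewrite inE.
  have [|jD] := boolP (j \in D); rewrite ?orbT ?orbF //.
  by rewrite -(isolated_closed iS (x := i)) // /adjR /adj /= iD jD ij jG.
apply/negP => jS; have jD : j \notin D.
  by move/fintype.subsetP: sSR => /(_ _ jS); rewrite inE.
move/negP: iS'; apply.
by rewrite (isolated_closed iS (y := j)) // /adjR /adj /= iD jD ij jG.
Qed.

(** Union bound over [S] in counting form, separately for each deleted set [D]. *)
Lemma card_isolated_le gamma (P : pred nat) :
  (#|[set w : outcome n | admissible K gamma w &&
        [exists S, isolated_in w S && P #|S| ]]| <=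
   \sum_(D : {set 'I_n} | #|D| == gamma)
     \sum_(S : {set 'I_n} | (S \subset ~: D) && P #|S|)
       #|family (fun i => mem (out_choices (allowed D S i) i))|)%N.
Proof.
set A := [set w : outcome n | admissible K gamma w &&
  [exists S, isolated_in w S && P #|S| ]].
pose f G D : nat := if (G, D) \in A then 1 else 0.
have -> : #|A| = (\sum_(w : outcome n) f w.1 w.2)%N.
  by rewrite -sum1_card big_mkcond /=; apply: eq_bigr => -[].
rewrite -(pair_bigA _ f) /f /A.
rewrite exchange_big /= [leqRHS]big_mkcond /=; apply: leq_sum => D _.
under eq_bigr do rewrite inE /=.
case: ifPn => cD; last first.
  by rewrite big1 // => G _; rewrite /admissible /= (negPf cD) andbF.
under [leqRHS]eq_bigr => S _ do rewrite -sum1_card big_mkcond.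
rewrite exchange_big /=; apply: leq_sum => G _.
case: ifP => // /andP[aG /existsP[S /andP[iS PS]]].
have sSR : S \subset ~: D by case/andP: iS.
by rewrite (bigD1 S) ?sSR ?PS //= (isolated_allowed aG iS).
Qed.
End Counting.

(** * Probability estimates for cuts *)

Section CutProbability.
Context {R : realType}.

(* Upper bound for the probability that a given set of [s] surviving vertices
   is isolated, once the [gamma] deleted vertices are fixed. *)
Definition cut_bound (n K gamma s : nat) : R :=
  ((s + gamma)%:R / n%:R) ^+ (K * s) *
  ((n - s)%:R / n%:R) ^+ (K * (n - gamma - s)).

(** By [leq_bin_expn] each vertex costs a factor [(|allowed| / n) ^ K]: there are [s + gamma]
    allowed vertices for members of [S], [n - s] for survivors outside [S], and [n] for deleted
    vertices, whose factor is [1]. *)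
Lemma card_allowed_le n K (D S : {set 'I_n}) :
  (0 < n)%N -> S \subset ~: D ->
  #|family (fun i => mem (out_choices K (allowed D S i) i))|%:R <=
  'C(n.-1, K)%:R ^+ n * cut_bound n K #|D| #|S|.
Proof.
move=> n0 sSD; have nR : 0 < n%:R :> R by rewrite ltr0n.
have cS : #|~: S| = (n - #|S|)%N by rewrite cardsCs finset.setCK card_ord.
have dSD : #|S :|: D| = (#|S| + #|D|)%N.
  by apply/eqP; rewrite (leq_card_setU S D) finset.disjoints_subset.
rewrite card_Gamma; last exact: mem_allowed.
rewrite natr_prod.
apply: (@le_trans _ _ (\prod_(i < n)
    ('C(n.-1, K)%:R * (#|allowed D S i|%:R / n%:R) ^+ K))).
  apply: ler_prod => i _; rewrite ler0n /= expr_div_n mulrA ler_pdivlMr ?exprn_gt0 //.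
  rewrite -!natrX -!natrM ler_nat.
  have T0 : (0 < #|allowed D S i|)%N by apply/card_gt0P; exists i; exact: mem_allowed.
  have Tn : (#|allowed D S i| <= n)%N by rewrite -[leqRHS]card_ord max_card.
  have := @leq_bin_expn #|allowed D S i|.-1 n.-1 K; rewrite !prednK //; apply.
  by rewrite -ltnS !prednK.
rewrite big_split /= prodr_const card_ord ler_wpM2l ?exprn_ge0 //.
rewrite prodrXl /cut_bound (exprM _ K #|S|) (exprM _ K (n - _ - _)).
rewrite -!exprM ![(K * _)%N]mulnC !exprM -exprMn.
rewrite le_eqVlt; apply/orP; left; apply/eqP; congr (_ ^+ _).
rewrite (bigID (mem S)) /=; congr (_ * _).
  rewrite -(prodr_const (mem S)); apply: eq_bigr => i iS.
  by rewrite /allowed iS dSD.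
rewrite (bigID (mem D)) /= big1 ?mul1r; last first.
  move=> i /andP[/negPf iS iD]; rewrite /allowed iS iD.
  by rewrite cardsT card_ord divff // gt_eqF.
have -> : (n - #|D| - #|S|)%N = #|~: (S :|: D)|.
  by rewrite [RHS]cardsCs finset.setCK card_ord dSD; lia.
rewrite -(prodr_const (mem (~: (S :|: D)))); apply: eq_big => i.
  by rewrite !inE negb_or.
by move=> /andP[/negPf iS /negPf iD]; rewrite /allowed iS iD cS.
Qed.

(** This is a single term of the expansion of [(p + (1 - p)) ^ m = 1]. *)
Lemma bin_term_le1 (m s : nat) (p : R) :
  0 <= p -> p <= 1 -> (s <= m)%N ->
  'C(m, s)%:R * (p ^+ s * (1 - p) ^+ (m - s)) <= 1.
Proof.
move=> p0 p1 sm; apply: le_trans (_ : ((1 - p) + p) ^+ m <= 1); last first.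
  by rewrite subrK expr1n.
have sm1 : (s < m.+1)%N by [].
rewrite [leRHS]exprDn (bigD1 (Ordinal sm1)) //=.
rewrite mulr_natl [p ^+ s * _]mulrC lerDl sumr_ge0 // => i _.
by rewrite mulrn_wge0 // mulr_ge0 // exprn_ge0 // subr_ge0.
Qed.

(* The quadratic term matters: [1 - y <= expR (- y)] would only bound the base in
   [cut_base_le] by [1] at [s = n / 2]. *)
Lemma oneB_le_expR (y : R) : 0 <= y <= 1 -> 1 - y <= expR (- y - y ^+ 2 / 4).
Proof.
move=> y01; set t := y + y ^+ 2 / 4.
have -> : - y - y ^+ 2 / 4 = 2%:R * - (t / 2) by rewrite /t; field.
rewrite expRM_natl.
have h : 1 - t / 2 <= expR (- (t / 2)) by apply: le_trans (expR_ge1Dx _).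
have t2 : 0 <= 1 - t / 2 by rewrite /t; nra.
(* With this [t] the quadratic terms cancel: the square exceeds [1 - y] by exactly
   [y ^ 3 / 8 + y ^ 4 / 64]. *)
apply: le_trans (_ : (1 - t / 2) ^+ 2 <= _).
  rewrite /t; have : 0 <= y ^+ 3 by rewrite exprn_ge0 //; lra.
  have : 0 <= y ^+ 4 by rewrite exprn_ge0 //; lra.
  nra.
by rewrite lerXn2r // nnegrE // expR_ge0.
Qed.

(** With [y = s / n] and [g = gamma / n], both factors are bounded by exponentials, the first
    through [2 (y + g) <= 1 + 2 g], and the exponents are compared. *)
Lemma cut_base_le (n gamma s : nat) :
  (0 < n)%N -> (2 * s <= n - gamma)%N -> (128 * gamma <= n)%N ->
  (2 * expR 2^-1) ^+ s * (((s + gamma)%:R / n%:R) ^+ s *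
     ((n - s)%:R / n%:R) ^+ (n - gamma - s)) <= expR (- 32^-1) ^+ s :> R.
Proof.
move=> n0 s2 g128; have nR : 0 < n%:R :> R by rewrite ltr0n.
pose y : R := s%:R / n%:R; pose g : R := gamma%:R / n%:R.
have sE : s%:R = y * n%:R by rewrite /y divfK // gt_eqF.
have gE : gamma%:R = g * n%:R by rewrite /g divfK // gt_eqF.
have y0 : 0 <= y by rewrite divr_ge0.
have g0 : 0 <= g by rewrite divr_ge0.
have y2 : y <= 2^-1.
  by rewrite ler_pdivrMr // mulrC ler_pdivlMr // -natrM ler_nat; lia.
have g1 : g <= 128^-1.
  by rewrite ler_pdivrMr // mulrC ler_pdivlMr // -natrM ler_nat; lia.
have -> : (s + gamma)%:R / n%:R = y + g :> R by rewrite natrD mulrDl.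
have -> : (n - s)%:R / n%:R = 1 - y :> R.
  by rewrite natrB ?mulrBl ?divff ?gt_eqF //; lia.
have mE : (n - gamma - s)%:R = n%:R * (1 - y - g) :> R.
  rewrite !natrB; [|lia..]; rewrite sE gE; ring.
rewrite mulrA -exprMn.
have e0 := @expR_ge0 R.
have h1 : 2 * expR 2^-1 * (y + g) <= expR (2^-1 + 2 * g).
  rewrite expRD mulrAC [leRHS]mulrC ler_wpM2r //.
  by apply: le_trans (expR_ge1Dx _); lra.
have h2 : 1 - y <= expR (- y - y ^+ 2 / 4) by apply: oneB_le_expR; lra.
apply: le_trans (_ : expR (2^-1 + 2 * g) ^+ s *
    expR (- y - y ^+ 2 / 4) ^+ (n - gamma - s) <= _).
  have z1 : 0 <= 1 - y by lra.
  have z2 : 0 <= 2 * expR 2^-1 * (y + g) by rewrite !mulr_ge0 // addr_ge0.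
  by apply: ler_pM; rewrite ?exprn_ge0 // lerXn2r // nnegrE.
rewrite -!expRM_natl -expRD ler_expR mE sE.
rewrite -subr_ge0.
have -> : y * n%:R * - 32^-1 - (y * n%:R * (2^-1 + 2 * g) +
    n%:R * (1 - y - g) * (- y - y ^+ 2 / 4)) =
    y * n%:R * (1 - y - g - 2^-1 - 2 * g - 32^-1 + y * (1 - y - g) / 4) by field.
(* The last factor decreases in [y] and in [g]; at the extreme point [y = 1/2], [g = 1/128] it
   equals [7/1024]. *)
rewrite !mulr_ge0 //; nra.
Qed.

(* The binomial coefficient is absorbed by one of the [k.+1] factors through
   [bin_term_le1] at [p = s / n]; what remains is the ratio [1 + gamma / s] and
   [k] copies of the base estimated in [cut_base_le]. *)
Lemma bin_cut_bound_le (n gamma k s : nat) :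
  (0 < k)%N -> (0 < s)%N -> (2 * s <= n - gamma)%N -> (128 * gamma <= n)%N ->
  1 + gamma%:R / s%:R <= (2 * expR 2^-1) ^+ k :> R ->
  'C(n - gamma, s)%:R * cut_bound n k.+1 gamma s <= expR (- 32^-1) ^+ s.
Proof.
move=> k0 s0 s2 g128 hk; have n0 : (0 < n)%N by lia.
have nR : 0 < n%:R :> R by rewrite ltr0n.
have sR : 0 < s%:R :> R by rewrite ltr0n.
set X := (s + gamma)%:R / n%:R : R; set Z := (n - s)%:R / n%:R : R.
have X0 : 0 <= X by rewrite divr_ge0.
have Z0 : 0 <= Z by rewrite divr_ge0.
pose r : R := 1 + gamma%:R / s%:R.
have r0 : 0 <= r by rewrite addr_ge0 ?divr_ge0.
pose y : R := s%:R / n%:R.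
have y0 : 0 <= y by rewrite divr_ge0.
have XE : X = r * y.
  by rewrite /X /r /y natrD; field; rewrite !gt_eqF.
have ZE : Z = 1 - y.
  by rewrite /Z natrB ?mulrBl ?divff ?gt_eqF //; lia.
set m := (n - gamma - s)%N; set B := X ^+ s * Z ^+ m.
have B0 : 0 <= B by rewrite mulr_ge0 // exprn_ge0.
have -> : 'C(n - gamma, s)%:R * cut_bound n k.+1 gamma s =
   'C(n - gamma, s)%:R * (y ^+ s * (1 - y) ^+ m) * (r ^+ s * B ^+ k).
  rewrite /cut_bound -/X -/Z -/m !mulSn !exprD {1}XE {1}ZE /B !exprMn.
  by rewrite ![(k * _)%N]mulnC !exprM; ring.
apply: le_trans (_ : 1 * (r ^+ s * B ^+ k) <= _).
  rewrite ler_wpM2r ?mulr_ge0 ?exprn_ge0 // /m.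
  apply: bin_term_le1 => //; last by lia.
  by rewrite -subr_ge0 -ZE.
rewrite mul1r; set q := expR (- 32^-1).
have q0 : 0 <= q by exact: expR_ge0.
have q1 : q <= 1 by rewrite expR_le1; lra.
apply: le_trans (_ : ((2 * expR 2^-1) ^+ s * B) ^+ k <= _).
  rewrite [leRHS]exprMn ler_wpM2r ?exprn_ge0 // -exprM mulnC exprM.
  by rewrite lerXn2r // nnegrE // exprn_ge0 // mulr_ge0 // expR_ge0.
have b0 : 0 <= (2 * expR 2^-1) ^+ s * B.
  by rewrite mulr_ge0 // exprn_ge0 // mulr_ge0 // expR_ge0.
apply: le_trans (_ : (q ^+ s) ^+ k <= _).
  by rewrite lerXn2r // ?nnegrE ?exprn_ge0 //; exact: cut_base_le.
by rewrite -exprM; apply: ler_wiXn2l => //; exact: leq_pmulr.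
Qed.

Lemma sum_subsets_card (T : finType) (N : nat) (A : {set T}) (P : pred nat)
    (f : nat -> R) :
  (#|A| <= N)%N ->
  \sum_(S : {set T} | (S \subset A) && P #|S|) f #|S| =
  \sum_(s < N.+1 | P s) 'C(#|A|, s)%:R * f s.
Proof.
move=> AN.
have SN (S : {set T}) : S \subset A -> (#|S| < N.+1)%N.
  by move=> /subset_leq_card h; rewrite ltnS (leq_trans h).
rewrite (partition_big (fun S : {set T} => inord #|S| : 'I_N.+1) (fun s => P s)) /=.
  apply: eq_bigr => s Ps.
  rewrite (eq_bigl (fun S : {set T} => S \in
    [set B : {set T} | B \subset A & #|B| == s])).
    under eq_bigr => S do rewrite inE => /andP[_ /eqP ->].
    by rewrite sumr_const cards_draws mulr_natl.
  move=> S; rewrite inE; have [sSA|//] := boolP (S \subset A).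
  rewrite -val_eqE /= inordK ?SN //.
  by have [->|] := eqVneq; rewrite ?Ps ?andbF.
by move=> S /andP[sSA PS]; rewrite inordK ?SN.
Qed.

Lemma sum_geo_le (q : R) (l N : nat) : 0 <= q < 1 ->
  \sum_(s < N | (l <= s)%N) q ^+ s <= q ^+ l / (1 - q).
Proof.
move=> /andP[q0 q1]; have q1' : 0 < 1 - q by rewrite subr_gt0.
have [lN|Nl] := leqP l N; last first.
  rewrite big1 ?divr_ge0 ?exprn_ge0 // ?ltW // => i li.
  by have := ltn_ord i; lia.
have sumE M : (l <= M)%N ->
    (\sum_(s < M | (l <= s)%N) q ^+ s) * (1 - q) = q ^+ l - q ^+ M.
  elim: M => [|M IHM] lM.
    by rewrite big_ord0 mul0r (_ : l = 0%N) ?subrr //; lia.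
  rewrite big_mkcond big_ord_recr -big_mkcond /=.
  have [lM'|] := leqP l M; first by rewrite mulrDl IHM // exprS; ring.
  move=> Ml; have -> : l = M.+1 by lia.
  rewrite addr0 subrr big1 ?mul0r // => i /=; have := ltn_ord i; lia.
by rewrite ler_pdivlMr // sumE ?lerBlDr ?lerDl ?exprn_ge0 //; lia.
Qed.

Lemma card_isolated_le_cut_bound n K gamma (P : pred nat) : (0 < n)%N ->
  #|[set w : outcome n | admissible K gamma w &&
        [exists S, isolated_in w S && P #|S| ]]|%:R <=
  #|[set w | @admissible n K gamma w]|%:R *
    \sum_(s < n.+1 | P s) 'C(n - gamma, s)%:R * cut_bound n K gamma s.
Proof.
move=> n0; rewrite card_admissible natrM natrX -mulrA.
have := @card_isolated_le n K gamma P; rewrite -(ler_nat R); move=> /le_trans; apply.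
set Q := (X in _ <= _ * X).
(* The bound [Q] depends on [D] only through its size, so summing over [D] yields the factor
   ['C(n, gamma)] of the admissible count. *)
apply: le_trans (_ : \sum_(D : {set 'I_n} | #|D| == gamma) Q <= _); last first.
  rewrite sumr_const mulr_natl; have := cards_draws [set: 'I_n] gamma.
  rewrite cardsT card_ord => <-.
  rewrite le_eqVlt; apply/orP; left; apply/eqP; congr (_ *+ _).
  by apply: eq_card => A; rewrite !inE finset.subsetT.
rewrite natr_sum; apply: ler_sum => D /eqP cD; rewrite natr_sum /Q.
have cDC : #|~: D| = (n - gamma)%N by rewrite cardsCs finset.setCK card_ord cD.
rewrite -cDC -sum_subsets_card; last by rewrite -[leqRHS]card_ord max_card.
rewrite mulr_sumr; apply: ler_sum => S /andP[sSD _].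
by rewrite -cD; exact: card_allowed_le.
Qed.

(** Failure for [lambda] implies failure for the smaller [mu], while [mu <= n / 8] leaves room for
    the condition [4 l <= n - gamma] of [small_Cmax_isolated]. *)
Lemma prob_Cmax_le (n k gamma : nat) (lambda mu : R) :
  (64 <= n)%N -> (0 < k)%N -> (k.+1 < n)%N -> (128 * gamma <= n)%N ->
  0 < mu -> mu <= lambda -> mu <= n%:R / 8 ->
  1 + gamma%:R / mu <= (2 * expR 2^-1) ^+ k ->
  `|1 - prob k.+1 gamma
    (fun w : outcome n => n%:R - gamma%:R - lambda < (Cmax_size w)%:R)| <=
  expR (- (mu / 32)) / (1 - expR (- 32^-1)).
Proof.
move=> n64 k0 kn g128 mu0 mul mu8 hk; have n0 : (0 < n)%N by lia.
set E := fun w : outcome n => _; set q := expR (- 32^-1).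
have q0 : 0 < q by exact: expR_gt0.
have q1 : q < 1 by rewrite expR_lt1; lra.
have exl : exists l, mu <= l%:R.
  by exists (Num.bound mu); apply/ltW/archi_boundP/ltW.
(* [l] is the ceiling of [mu]: an integer number of missed vertices that is at least [mu] is at
   least [l]. *)
case: (ex_minnP exl) => l mul' minl.
have l0 : (0 < l)%N by rewrite -(ltr0n R) (lt_le_trans mu0).
have l8 : (l <= (n %/ 8).+1)%N.
  apply: minl; apply: le_trans mu8 _; rewrite ler_pdivrMr // -natrM ler_nat; lia.
set adm := [set w | @admissible n k.+1 gamma w].
pose bad := [set w : outcome n | @admissible n k.+1 gamma w && ~~ E w].
pose P s := (l <= s)%N && (2 * s <= n - gamma)%N.
(* Since [k.+1 < n] and [gamma <= n], admissible outcomes exist and the quotient defining [prob] is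
   genuine. *)
have adm0 : 0 < #|adm|%:R :> R.
  rewrite ltr0n card_admissible muln_gt0 expn_gt0 !bin_gt0; lia.
have badE : 1 - prob k.+1 gamma E = #|bad|%:R / #|adm|%:R :> R.
  rewrite /prob -/adm; apply/eqP; rewrite subr_eq -mulrDl -natrD; apply/eqP.
  have -> : (#|bad| + #|[set w | @admissible n k.+1 gamma w && E w]| = #|adm|)%N.
    rewrite addnC -[RHS](cardsID [set w | E w]); congr addn.
      by apply: eq_card => w; rewrite !inE.
    by apply: eq_card => w; rewrite !inE andbC.
  by rewrite divff // gt_eqF.
rewrite badE ger0_norm ?divr_ge0 //.
have bad_sub : bad \subset [set w : outcome n | admissible k.+1 gamma w &&
        [exists S, isolated_in w S && P #|S| ]].
  apply/fintype.subsetP => w; rewrite !inE => /andP[aw]; rewrite aw /E -leNgt => hC.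
  have cD : #|w.2| = gamma by case/andP: aw => _ /eqP.
  have cDC : #|~: w.2| = (n - gamma)%N by rewrite cardsCs finset.setCK card_ord cD.
  have gn : (gamma <= n)%N by lia.
  have CR : (Cmax_size w <= n - gamma)%N.
    rewrite -(ler_nat R) natrB //; lra.
  have lC : (l <= n - gamma - Cmax_size w)%N.
    by apply: minl; rewrite !natrB //; lra.
  have [|| S [iS lS S2]] := @small_Cmax_isolated n w l; rewrite ?cDC; [lia..|].
  by apply/existsP; exists S; rewrite iS /P lS -cDC S2.
rewrite ler_pdivrMr // mulrC.
apply: le_trans (_ : _ <= #|adm|%:R *
    \sum_(s < n.+1 | P s) 'C(n - gamma, s)%:R * cut_bound n k.+1 gamma s) _.
  apply: le_trans (card_isolated_le_cut_bound _ _ _ n0).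
  by rewrite ler_nat subset_leq_card.
rewrite ler_wpM2l //.
apply: le_trans (_ : \sum_(s < n.+1 | (l <= s)%N) q ^+ s <= _).
  rewrite [leRHS](bigID (fun s : 'I_n.+1 => (2 * s <= n - gamma)%N)) /=.
  rewrite -[leLHS]addr0 lerD ?sumr_ge0 // => [|i _]; last by rewrite exprn_ge0 // ltW.
  apply: ler_sum => s /andP[ls s2]; apply: bin_cut_bound_le => //.
    exact: leq_trans ls.
  apply: le_trans hk; rewrite lerD2l ler_wpM2l // lef_pV2 ?posrE //.
    by rewrite (le_trans mul') // ler_nat.
  by rewrite ltr0n (leq_trans l0).
apply: le_trans (sum_geo_le _ _ _) _; first by rewrite ltW.
rewrite ler_wpM2r ?invr_ge0 ?subr_ge0 ?(ltW q1) //.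
rewrite /q -expRM_natl ler_expR mulrN lerN2 ler_pM2r //; lra.
Qed.
End CutProbability.

(** The denominator in [r3] is the logarithm of [2 sqrt e], so exponentiating the threshold gives
    the bound; [k > 0] because [r3] is at least [1]. *)
Lemma r3_lt_expX {R : realType} (gamma lambda : R) (k : nat) :
  0 <= gamma -> 0 < lambda -> r3 gamma lambda < k.+1%:R ->
  (0 < k)%N /\ 1 + gamma / lambda <= (2 * expR 2^-1) ^+ k.
Proof.
move=> g0 l0; rewrite /r3 -(natr1 k) [ltLHS]addrC ltrD2r => h.
have x1 : 1 <= 1 + gamma / lambda by rewrite lerDl divr_ge0 // ltW.
have c0 : 0 < ln 2 + 2^-1 :> R by rewrite addr_gt0 ?ln_gt0 ?ltr1n.
move: (h); rewrite ltr_pdivrMr // => {}h'.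
split.
  rewrite -(ltr0n R); apply: le_lt_trans h.
  by rewrite divr_ge0 ?ln_ge0 // ltW.
have -> : 2 * expR 2^-1 = expR (ln 2 + 2^-1) :> R by rewrite expRD lnK // posrE.
rewrite -expRM_natl -[leLHS]lnK ?posrE ?(lt_le_trans _ x1) //.
by rewrite ler_expR ltW.
Qed.

(** * Passage to the limit *)

Local Open Scope classical_set_scope.

Theorem theorem3p3 (R : realType) (gamma K : nat -> nat) (lambda : nat -> R) :
  little_o_n (fun n => (gamma n)%:R : R) ->
  big_omega_sqrt lambda ->
  (exists N : nat, forall n, (N <= n)%N -> (K n < n)%N) ->
  (forall n, r3 (gamma n)%:R (lambda n) < (K n)%:R) ->
  (fun n => prob (R:=R) (K n) (gamma n)
     (fun w : outcome n => (n%:R - (gamma n)%:R - lambda n < (Cmax_size w)%:R)))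
    @ \oo --> (1 : R^o).
Proof.
move=> /(_ 128^-1) [|N1 hg]; first by [].
move=> [c [c0 [N2 hl]]] [N3 hK] hr; apply/cvgrPdist_lt => eps eps0.
(* Both [lambda n] and [n / 8] are eventually at least [d * sqrt n], hence so is their minimum
   [mu]. *)
pose d : R := Num.min c 8^-1.
have d0 : 0 < d by rewrite lt_min c0 /=.
pose q : R := expR (- 32^-1).
have q1 : 0 < 1 - q by rewrite subr_gt0 expR_lt1; lra.
(* Chosen so that [expR (Z / 32) > Z / 32 = 1 / (eps (1 - q))], which puts the tail bound below
   [eps]; [N4] ensures [Z <= d * sqrt n]. *)
pose Z := 32 / (eps * (1 - q)).
have Z0 : 0 < Z by rewrite divr_gt0 // mulr_gt0.
pose N4 := Num.bound ((Z / d) ^+ 2).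
exists (N1 + N2 + N3 + N4 + 64)%N => //= n /= Nn.
have [N1n N2n N3n N4n n64] :
    [/\ N1 <= n, N2 <= n, N3 <= n, N4 <= n & 64 <= n]%N by split; lia.
have nR : 0 < n%:R :> R by rewrite ltr0n (leq_trans _ n64).
have dn : Z <= d * Num.sqrt n%:R.
  rewrite -ler_pdivrMl // mulrC -(ger0_norm (ltW (divr_gt0 Z0 d0))) -sqrtr_sqr.
  rewrite ler_sqrt ?ltW // (lt_le_trans (archi_boundP _)) ?exprn_ge0 //.
    by rewrite ltW // divr_gt0.
  by rewrite -/N4 ler_nat.
have sn : Num.sqrt n%:R <= n%:R :> R.
  have s1 : 1 <= Num.sqrt n%:R :> R.
    by rewrite -[leLHS]sqrtr1 ler_sqrt // ler1n (leq_trans _ n64).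
  have := sqr_sqrtr (ltW nR); nra.
have s0 : 0 <= Num.sqrt n%:R :> R by exact: sqrtr_ge0.
have [dc d8] : d <= c /\ d <= 8^-1 by rewrite /d; split; rewrite ge_min lexx ?orbT.
have ln : c * Num.sqrt n%:R <= lambda n by exact: hl.
pose mu := Num.min (lambda n) (n%:R / 8).
have Zmu : Z <= mu by rewrite /mu le_min; apply/andP; split; nra.
have mu0 : 0 < mu by exact: lt_le_trans Zmu.
have [mul mu8] : mu <= lambda n /\ mu <= n%:R / 8.
  by rewrite /mu; split; rewrite ge_min lexx ?orbT.
have g128 : (128 * gamma n <= n)%N.
  by rewrite -(ler_nat R) natrM; have := hg n N1n; rewrite ger0_norm //; lra.
have Kn : (K n < n)%N by exact: hK.
have := hr n; case: (K n) Kn => [|k] Kn.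
  rewrite /r3 ltNge => /negP[]; rewrite addr_ge0 // divr_ge0 //.
    by rewrite ln_ge0 // lerDl divr_ge0 // ltW // (lt_le_trans mu0).
  by rewrite addr_ge0 // ln_ge0 // ler1n.
move=> /r3_lt_expX[] //; first exact: lt_le_trans mul.
move=> k0 hk.
have hmu : 1 + (gamma n)%:R / mu <= (2 * expR 2^-1) ^+ k.
  (* When [mu = n / 8], the ratio [gamma / mu] is at most [1], and [2 <= (2 sqrt e) ^ k] because
     [k > 0]. *)
  rewrite /mu; case: (leP (lambda n)) => // _; apply: (@le_trans _ _ (2 : R)).
    have : (gamma n)%:R / (n%:R / 8) <= 1 :> R; last by lra.
    rewrite ler_pdivrMr ?divr_gt0 // mul1r ler_pdivlMr // -natrM ler_nat.
    by rewrite (leq_trans _ g128) // mulnC leq_mul2r orbT.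
  have e1 : 1 <= expR 2^-1 :> R by rewrite -expR0 ler_expR.
  rewrite -(prednK k0) exprS; have : 1 <= (2 * expR 2^-1 : R) ^+ k.-1.
    by rewrite exprn_ege1 //; lra.
  nra.
apply: le_lt_trans (prob_Cmax_le _ k0 Kn g128 mu0 mul mu8 hmu) _ => //.
rewrite -/q ltr_pdivrMr // expRN invf_plt ?posrE ?expR_gt0 ?mulr_gt0 //.
apply: lt_le_trans (expR_ge1Dx _).
have -> : (eps * (1 - q))^-1 = Z / 32 by rewrite /Z; field; rewrite !gt_eqF.
by lra.
Qed.
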